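(* For every finite directed acyclic graph $D=(V,E)$ and every threshold function $t:V\to\mathbb{N}$, every execution of the algorithm MTS on input $(D,t)$ returns a minimum-size target set for $D$ with thresholds $t$.
   Context: Digraphs are finite, without loops. For a digraph $G=(V,E)$ and $v\in V$, $\Gamma^{in}(v)=\{u:(u,v)\in E\}$ and $\Gamma^{out}(v)=\{u:(v,u)\in E\}$. Given thresholds $t:V\to\mathbb{N}=\{0,1,2,\dots\}$ and $S\subseteq V$, the activation process starting at $S$ is $A_0=S$ and $A_\ell=A_{\ell-1}\cup\{u\in V: |\Gamma^{in}(u)\cap A_{\ell-1}|\ge t(u)\}$ for $\ell\ge1$. $S$ is a target set for $(G,t)$ if $A_\lambda=V$ for some $\lambda\ge0$. Algorithm MTS on input $(G,t)$: set $S=\emptyset$, $L=\emptyset$, $U=V$, and for each $v\in V$ set $k(v)=t(v)$, $\delta(v)=|\Gamma^{in}(v)|$. While $U\neq\emptyset$, perform one iteration as follows. Case 1: if some $v\in U$ has $k(v)=0$, select such a $v$; for each $u\in\Gamma^{out}(v)\cap U$ set $k(u)=\max(k(u)-1,0)$ and, if $v\notin L$, set $\delta(u)=\delta(u)-1$; then set $U=U\setminus\{v\}$. Case 2: otherwise, if some $v\in U\setminus L$ has $\delta(v)<k(v)$, select such a $v$; set $S=S\cup\{v\}$; for each $u\in\Gamma^{out}(v)\cap U$ set $k(u)=k(u)-1$ and $\delta(u)=\delta(u)-1$; then set $U=U\setminus\{v\}$. Case 3: otherwise, select $v\in U\setminus L$ maximizing $\frac{k(u)}{\delta(u)(\delta(u)+1)}$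 over $u\in U\setminus L$; for each $u\in\Gamma^{out}(v)\cap U$ set $\delta(u)=\delta(u)-1$; set $L=L\cup\{v\}$. When $U=\emptyset$, return $S$. Whenever several nodes qualify in a case, one of them is chosen arbitrarily. *)

(* Defs.v *)
From mathcomp Require Import all_boot all_order all_algebra.

Set Implicit Arguments.
Unset Strict Implicit.
Unset Printing Implicit Defensive.

Section TargetSets.

(* A digraph is a finite vertex type V with an edge relation E;
   E u v stands for (u, v) \in E. *)
Variables (V : finType) (E : rel V).

Definition in_nbr (v : V) : {set V} := [set u | E u v].
Definition out_nbr (v : V) : {set V} := [set u | E v u].

Definition acyclic : Prop := forall c : seq V, cycle E c -> c = [::].

Variable t : V -> nat.

Fixpoint activation (S : {set V}) (l : nat) : {set V} :=
  if l is l'.+1 then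
    activation S l' :|: [set u | t u <= #|in_nbr u :&: activation S l'|]
  else S.

Definition target_set (S : {set V}) : Prop :=
  exists l : nat, activation S l = [set: V].

Definition minimum_target_set (S : {set V}) : Prop :=
  target_set S /\ (forall S' : {set V}, target_set S' -> #|S| <= #|S'|).

Record mts_state := MtsState {
  mts_S : {set V};
  mts_L : {set V};
  mts_U : {set V};
  mts_k : V -> nat;
  mts_delta : V -> nat
}.

Definition mts_init : mts_state :=
  MtsState set0 set0 [set: V] t (fun v => #|in_nbr v|).

Definition mts_ratio (k delta : V -> nat) (u : V) : rat :=
  ((k u)%:R / (delta u * (delta u).+1)%N%:R)%R.

(* One iteration of the while loop. The choice of v is free among the
   qualifying vertices, so the relation is nondeterministic. Each constructor
   needs some v in U, hence there is no step once U is empty.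
   On states reachable from mts_init, delta u is, for u in U, the number of
   in-neighbours of u in U :\: L, so the truncated subtractions of delta in all the cases,
   and that of k in case 2 (where k is positive on U), are genuine ones. In
   case 3 delta is positive on U :\: L, so mts_ratio never divides by zero. *)
Inductive mts_step : mts_state -> mts_state -> Prop :=
| MtsCase1 (S L U : {set V}) (k delta : V -> nat) (v : V) :
    v \in U -> k v = 0 ->
    mts_step (MtsState S L U k delta)
      (MtsState S L (U :\ v)
        (fun u => if u \in out_nbr v :&: U then maxn (k u - 1) 0 else k u)
        (fun u => if (u \in out_nbr v :&: U) && (v \notin L)
                  then delta u - 1 else delta u))
| MtsCase2 (S L U : {set V}) (k delta : V -> nat) (v : V) :
    (forall u, u \in U -> k u <> 0) ->
    v \in U :\: L -> delta v < k v ->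
    mts_step (MtsState S L U k delta)
      (MtsState (v |: S) L (U :\ v)
        (fun u => if u \in out_nbr v :&: U then k u - 1 else k u)
        (fun u => if u \in out_nbr v :&: U then delta u - 1 else delta u))
| MtsCase3 (S L U : {set V}) (k delta : V -> nat) (v : V) :
    (forall u, u \in U -> k u <> 0) ->
    (forall u, u \in U :\: L -> ~ (delta u < k u)) ->
    v \in U :\: L ->
    (forall u, u \in U :\: L ->
       (mts_ratio k delta u <= mts_ratio k delta v)%R) ->
    mts_step (MtsState S L U k delta)
      (MtsState S (v |: L) U k
        (fun u => if u \in out_nbr v :&: U then delta u - 1 else delta u)).

Inductive mts_reachable : mts_state -> Prop :=
| MtsReachInit : mts_reachable mts_init
| MtsReachStep st st' :
    mts_reachable st -> mts_step st st' -> mts_reachable st'.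

(* Every execution returns an output satisfying P: no execution goes on
   forever, none gets stuck while U is nonempty, and P holds of S whenever
   the loop is left. *)
Definition mts_always_returns (P : {set V} -> Prop) : Prop :=
  [/\ ~ (exists run : nat -> mts_state,
           run 0 = mts_init /\ forall n, mts_step (run n) (run n.+1)),
      forall st, mts_reachable st -> mts_U st <> set0 ->
        exists st', mts_step st st'
    & forall st, mts_reachable st -> mts_U st = set0 -> P (mts_S st)].

End TargetSets.

(* Main.v *)
Require Import Defs.
From mathcomp Require Import all_boot all_order all_algebra.
From mathcomp Require Import zify.

(** In an acyclic digraph every nonempty set [U] contains a vertex without
    in-neighbours in [U]. As long as case 3 has not been used, such a vertex has
    [delta = 0], so it qualifies for case 1 or case 2; hence case 3 is never
    used, [L] stays empty, and every iteration shrinks [U]. With [L] empty,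
    case 2 only selects vertices whose threshold exceeds their indegree, and
    these belong to every target set, whereas the other vertices leaving [U]
    are activated by the ones that left before. *)

Section Activation.

Variables (V : finType) (E : rel V) (t : V -> nat).

Lemma activation_mono (S S' : {set V}) l :
  S \subset S' -> activation E t S l \subset activation E t S' l.
Proof.
move=> sSS'; elim: l => [|l IHl] //=; apply: setUSS => //.
apply/subsetP=> u; rewrite !inE => /leq_trans; apply.
exact/subset_leq_card/setIS.
Qed.

Lemma sub_activation (S : {set V}) l : S \subset activation E t S l.
Proof. by elim: l => [|l IHl] //=; apply: subset_trans IHl (subsetUl _ _). Qed.

Definition unactivatable : {set V} := [set v | #|in_nbr E v| < t v].

(** Even with all in-neighbours active, such a vertex stays below its threshold, so no round can add
    it. *)
Lemma activation_unactivatable (S : {set V}) l :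
  unactivatable :&: activation E t S l \subset S.
Proof.
elim: l => [|l IHl] /=; first exact: subsetIr.
rewrite setIUr subUset IHl; apply/subsetP=> u.
rewrite !inE => /andP[lt_t le_t]; have := leq_trans lt_t le_t.
by rewrite ltnNge subset_leq_card // subsetIl.
Qed.

Lemma unactivatable_sub_target (S : {set V}) :
  target_set E t S -> unactivatable \subset S.
Proof.
by case=> l actT; have := activation_unactivatable S l; rewrite actT setIT.
Qed.

(** Take [v] in [U] with the fewest ancestors. An in-neighbour [w] of [v] in [U] would have strictly
    fewer: its ancestors are ancestors of [v], and [v] is not among them, as a path from [v] to [w]
    would close into a cycle. *)
Lemma acyclic_source (U : {set V}) :
  acyclic E -> U != set0 -> exists2 v, v \in U & in_nbr E v :&: U = set0.
Proof.
move=> acE /set0Pn[x xU].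
have [v vU minv] := arg_minnP (fun v => #|[set w | connect E w v]|) xU.
exists v => //; apply/setP=> w; rewrite !inE; apply/negP=> /andP[Ewv wU].
have /negP[] : ~~ (#|[set w' | connect E w' v]| <= #|[set w' | connect E w' w]|).
  rewrite -ltnNge proper_card // properE; apply/andP; split.
    apply/subsetP=> z; rewrite !inE => zw.
    exact: connect_trans zw (connect1 Ewv).
  apply/subsetPn; exists v; rewrite inE ?connect0 //.
  apply/negP=> /connectP[p vp w_last].
  by have/acE : cycle E (v :: p) by rewrite /= rcons_path vp -w_last.
exact: minv.
Qed.

Lemma card_nbr_setD1 (u v : V) (U : {set V}) : v \in U ->
  #|in_nbr E u :&: U| = (u \in out_nbr E v) + #|in_nbr E u :&: (U :\ v)|.
Proof.
by move=> vU; rewrite (cardsD1 v) !inE vU andbT setIDA.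
Qed.

Lemma card_nbr_setDD1 (u v : V) (U : {set V}) : v \in U ->
  #|in_nbr E u :\: (U :\ v)| = (u \in out_nbr E v) + #|in_nbr E u :\: U|.
Proof.
move=> vU; have := cardsID U (in_nbr E u); have := cardsID (U :\ v) (in_nbr E u).
by rewrite (card_nbr_setD1 u v U vU); lia.
Qed.

(** The subtraction in [inv_k] is truncated, matching the maximum with 0 in case 1. *)
Record mts_invariant (st : mts_state V) : Prop := MtsInvariant {
  inv_L : mts_L st = set0;
  inv_S : mts_S st \subset unactivatable;
  inv_k : {in mts_U st, forall u, mts_k st u = t u - #|in_nbr E u :\: mts_U st|};
  inv_delta : {in mts_U st, forall u, mts_delta st u = #|in_nbr E u :&: mts_U st|};
  inv_active : exists l, ~: mts_U st \subset activation E t (mts_S st) l }.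

Lemma mts_invariant_init : mts_invariant (mts_init E t).
Proof.
split=> //=; first exact: sub0set.
- by move=> u _; rewrite setDT cards0 subn0.
- by move=> u _; rewrite setIT.
- by exists 0; rewrite setCT.
Qed.

Hypothesis acyclicE : acyclic E.

Lemma mts_step_invariant (st st' : mts_state V) :
  mts_step E st st' -> mts_invariant st ->
  mts_invariant st' /\ #|mts_U st'| < #|mts_U st|.
Proof.
case=> S L U k delta v.
- move=> vU kv0 [/= -> Ssub kE dE [l actU]].
  split; last by rewrite [X in _ < X](cardsD1 v) vU.
  split=> //=.
  + move=> u /setD1P[_ uU]; rewrite (card_nbr_setDD1 u v U vU) in_setI uU andbT kE //.
    by case: ifP => _; lia.
  + move=> u /setD1P[_ uU]; have := card_nbr_setD1 u v U vU.
    by rewrite in_setI uU andbT in_set0 andbT dE //; case: ifP => _; lia.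
  + exists l.+1; apply/subsetP=> u; rewrite !inE negb_and negbK.
    case/orP=> [/eqP->|uU]; last first.
      by rewrite (subsetP actU) // inE.
    (* [k v = 0] says that at least [t v] in-neighbours lie outside [U]; these are active at stage
       [l], so [v] is active at stage [l.+1]. *)
    apply/orP; right; have := kE v vU; rewrite kv0 => /esym/eqP.
    rewrite subn_eq0 => /leq_trans; apply; rewrite setDE.
    exact/subset_leq_card/setIS.
- move=> knz /setDP[vU _] ltv [/= -> Ssub kE dE [l actU]].
  split; last by rewrite [X in _ < X](cardsD1 v) vU.
  split=> //=.
  + rewrite subUset Ssub sub1set inE andbT.
    (* In-neighbours inside and outside [U] add up to the indegree, so [delta v < k v] puts it below
       [t v]. *)
    by move: ltv; rewrite kE // dE // -(cardsID U (in_nbr E v)); lia.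
  + move=> u /setD1P[_ uU]; rewrite (card_nbr_setDD1 u v U vU) in_setI uU andbT kE //.
    by case: ifP => _; lia.
  + move=> u /setD1P[_ uU]; have := card_nbr_setD1 u v U vU.
    by rewrite in_setI uU andbT dE //; case: ifP => _; lia.
  + exists l; apply/subsetP=> u; rewrite !inE negb_and negbK.
    case/orP=> [/eqP->|uU].
      by rewrite (subsetP (sub_activation _ _)) // setU11.
    by rewrite (subsetP (activation_mono S _ l (subsetUr _ _))) // (subsetP actU) // inE.
(* Case 3 is contradictory: a source [s] of [U] has [delta s = 0 < k s]. *)
- move=> knz dk /setDP[vU _] _ [/= L0 Ssub kE dE _].
  have [|s sU s0] := acyclic_source U acyclicE; first by apply/set0Pn; exists v.
  case: (dk s); first by rewrite L0 setD0.
  by rewrite dE // s0 cards0 lt0n; apply/eqP/knz.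
Qed.

Lemma mts_reachable_invariant (st : mts_state V) :
  mts_reachable E t st -> mts_invariant st.
Proof.
elim=> [|st1 st2 _ inv1 step12]; first exact: mts_invariant_init.
by have [] := mts_step_invariant _ _ step12 inv1.
Qed.

Lemma mts_progress (st : mts_state V) :
  mts_invariant st -> mts_U st <> set0 -> exists st', mts_step E st st'.
Proof.
case: st => S L U k delta [/= L0 _ _ dE _] /eqP Un0.
have [v /andP[vU /eqP kv0] | noz] := pickP [pred v in U | k v == 0].
  by eexists; apply: (@MtsCase1 _ _ S L U k delta v).
have knz u : u \in U -> k u <> 0.
  by move=> uU /eqP ku0; have := noz u; rewrite /= uU ku0.
have [v vU v0] := acyclic_source U acyclicE Un0.
eexists; apply: (@MtsCase2 _ _ S L U k delta v) => //; first by rewrite L0 setD0.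
by rewrite dE // v0 cards0 lt0n; apply/eqP/knz.
Qed.

Lemma mts_invariant_final (st : mts_state V) :
  mts_invariant st -> mts_U st = set0 -> minimum_target_set E t (mts_S st).
Proof.
move=> [_ Ssub _ _ [l actU]] U0; split.
  by exists l; apply/eqP; rewrite -subTset -setC0 -U0.
move=> S' /unactivatable_sub_target sub'.
exact/subset_leq_card/(subset_trans Ssub sub').
Qed.

Lemma mts_terminates (run : nat -> mts_state V) :
  run 0 = mts_init E t -> ~ (forall n, mts_step E (run n) (run n.+1)).
Proof.
move=> run0 stepn.
(* Each step removes a vertex from [U], so [n = #|V|.+1] is impossible. *)
have inv n : mts_invariant (run n) /\ #|mts_U (run n)| + n <= #|V|.
  elim: n => [|n [invn leU]].
    by rewrite run0 addn0; split; [exact: mts_invariant_init | exact: max_card].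
  have [invS ltU] := mts_step_invariant _ _ (stepn n) invn.
  by split=> //; lia.
by have [_] := inv #|V|.+1; lia.
Qed.

End Activation.

Theorem theorem6 (V : finType) (E : rel V) (loopless : irreflexive E)
  (acyclicE : acyclic E) (t : V -> nat) :
  mts_always_returns E t (minimum_target_set E t).
Proof.
split.
- by case=> run [run0 /(mts_terminates V E t acyclicE _ run0)].
- by move=> st /(mts_reachable_invariant V E t acyclicE)/(mts_progress V E t acyclicE).
- by move=> st /(mts_reachable_invariant V E t acyclicE); apply: mts_invariant_final.
Qed.
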